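(* There is an infinite family of pairwise non-isomorphic minimal obstructions to $C_5$-coloring each of which is simultaneously $P_{13}$-free, $S_{2,2,2}$-free, $S_{5,5,1}$-free, $S_{11,1,1}$-free, and $S_{8,2,1}$-free.
   Context: All graphs are finite and simple. For graphs $G$ and $H$, an $H$-coloring of $G$ is a map $c: V(G)\to V(H)$ such that $c(u)c(v)\in E(H)$ for every edge $uv\in E(G)$. A graph $G$ is a minimal obstruction to $H$-coloring if $G$ has no $H$-coloring but every proper induced subgraph of $G$ has an $H$-coloring. $C_5$ is the cycle on five vertices and $P_t$ is the path on $t$ vertices. For integers $a,b,c\ge 1$, $S_{a,b,c}$ is the graph obtained from the paths $P_{a+1},P_{b+1},P_{c+1}$ by identifying one endvertex of each of them into a single vertex. A graph is $F$-free if it does not contain $F$ as an induced subgraph. *)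

(* Defs.v *)
From HB Require Import structures.
From mathcomp Require Import all_boot.

Set Implicit Arguments.
Unset Strict Implicit.
Unset Printing Implicit Defensive.

Record sgraph := SGraph {
  vertex :> finType;
  adj : rel vertex;
  adj_sym : symmetric adj;
  adj_irr : irreflexive adj }.

Arguments adj {s} x y : rename.

Definition isomorphic (G H : sgraph) : Prop :=
  exists2 f : G -> H, bijective f & forall x y : G, adj (f x) (f y) = adj x y.

Section Induced.
Variables (G : sgraph) (A : {set G}).

Definition induced_adj : rel {x : G | x \in A} := fun u v => adj (val u) (val v).

Lemma induced_sym : symmetric induced_adj.
Proof. by move=> u v; apply: adj_sym. Qed.

Lemma induced_irr : irreflexive induced_adj.
Proof. by move=> u; apply: adj_irr. Qed.

Definition induced : sgraph := SGraph induced_sym induced_irr.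
End Induced.

Definition colorable (H G : sgraph) : Prop :=
  exists c : G -> H, forall u v : G, adj u v -> adj (c u) (c v).

Definition minimal_obstruction (H G : sgraph) : Prop :=
  ~ colorable H G /\
  forall A : {set G}, A \proper [set: G] -> colorable H (induced A).

Definition free (F G : sgraph) : Prop :=
  ~ exists A : {set G}, isomorphic F (induced A).

Definition consecutive (i j : nat) : bool := (j == i.+1) || (i == j.+1).

Lemma consecutive_sym : symmetric consecutive.
Proof. by move=> i j; rewrite /consecutive orbC. Qed.

Lemma consecutive_irr : irreflexive consecutive.
Proof. by move=> i; rewrite /consecutive orbb -[i in i == _]addn0 -addn1 eqn_add2l. Qed.

Section Path.
Variable t : nat.

Definition path_adj : rel 'I_t := fun i j => consecutive i j.

Lemma path_sym : symmetric path_adj.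
Proof. by move=> i j; apply: consecutive_sym. Qed.

Lemma path_irr : irreflexive path_adj.
Proof. by move=> i; apply: consecutive_irr. Qed.

Definition path_graph : sgraph := SGraph path_sym path_irr.
End Path.

Definition C5_adj : rel 'I_5 :=
  fun i j => (j == i.+1 %% 5 :> nat) || (i == j.+1 %% 5 :> nat).

Lemma C5_sym : symmetric C5_adj.
Proof. by move=> i j; rewrite /C5_adj orbC. Qed.

Lemma C5_irr : irreflexive C5_adj.
Proof. by case=> [[|[|[|[|[|i]]]]] lt_i5]. Qed.

Definition C5 : sgraph := SGraph C5_sym C5_irr.

(* [None] is the common endvertex of the three paths; the element [i] of the *)
(* summand ['I_a] is the vertex at distance [i.+1] from it on the path with  *)
(* [a.+1] vertices, and likewise for ['I_b] and ['I_c].                      *)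
Section Spider.
Variables a b c : nat.

Definition spider_adj : rel (option ('I_a + 'I_b + 'I_c)) := fun u v =>
  match u, v with
  | Some (inl (inl i)), Some (inl (inl j)) => consecutive i j
  | Some (inl (inr i)), Some (inl (inr j)) => consecutive i j
  | Some (inr i), Some (inr j) => consecutive i j
  | None, Some (inl (inl i)) | Some (inl (inl i)), None => i == 0 :> nat
  | None, Some (inl (inr i)) | Some (inl (inr i)), None => i == 0 :> nat
  | None, Some (inr i) | Some (inr i), None => i == 0 :> nat
  | _, _ => false
  end.

Lemma spider_sym : symmetric spider_adj.
Proof. by move=> [[[i|i]|i]|] [[[j|j]|j]|] //=; apply: consecutive_sym. Qed.

Lemma spider_irr : irreflexive spider_adj.
Proof. by move=> [[[i|i]|i]|] //=; apply: consecutive_irr. Qed.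

Definition spider : sgraph := SGraph spider_sym spider_irr.
End Spider.

(* Main.v *)
Require Import Defs.
From mathcomp Require Import all_boot.
From mathcomp Require Import zify.

Set Implicit Arguments.
Unset Strict Implicit.
Unset Printing Implicit Defensive.

(** The graphs are the circulants on [Z/N], [N = 5n + 18], where two vertices
    are adjacent when they are consecutive or their difference is [4] mod [5]
    (as [N = 3] mod [5], this is symmetric).

    Any five cyclically consecutive vertices form a 5-cycle, so a C5-coloring
    satisfies [c (i + 5) = c i]; since [N = 3] mod [5], it would be constant.
    Conversely, if a vertex [z] is deleted, cutting the circle at [z] embeds the
    rest in the graph [lin] on the natural numbers, which is C5-colored by the
    residues mod 5.

    An induced copy of one of the forbidden trees misses some vertex, so it also
    lies in [lin].  If [j = i + 1] mod [5] then [i] and [j] are adjacent in [lin]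
    exactly when [j <= i + 1].  Hence adjacencies and non-adjacencies between
    successive residue classes are inequalities between positions, and some
    cyclic systems of these are contradictory.  Three such contradictions are
    enough to exclude all assignments of residues to the vertices of the trees,
    by a small exhaustive search. *)

(** * The linear graph and its three cyclic contradictions *)

Definition lin (i j : nat) : bool :=
  [|| consecutive i j, (j - i) %% 5 == 4 | (i - j) %% 5 == 4].

Lemma lin_sym : symmetric lin.
Proof. by move=> i j; rewrite /lin consecutive_sym [X in _ || X]orbC. Qed.

Lemma lin_succ_mod (i j : nat) : j = i.+1 %[mod 5] -> lin i j = (j <= i.+1).
Proof. by rewrite /lin /consecutive; lia. Qed.

Lemma lin_mod_C5 (i j : nat) :
  lin i j -> (j %% 5 == (i %% 5).+1 %% 5) || (i %% 5 == (j %% 5).+1 %% 5).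
Proof. by rewrite /lin /consecutive; lia. Qed.

(** If [j = i + 1] mod 5, failure would give [j <= i + 1 < j' <= i' + 1 < j]; the other orientation
    is symmetric. *)
Lemma lin_2K2_free (i j i' j' : nat) :
  i = i' %[mod 5] -> j = j' %[mod 5] -> lin i j -> lin i' j' ->
  lin i j' || lin i' j.
Proof.
wlog ij : i j i' j' / j = i.+1 %[mod 5] => [W ii jj l l'|ii jj].
  have [ij|ji] : j = i.+1 %[mod 5] \/ i = j.+1 %[mod 5].
    by move/lin_mod_C5: l; lia.
    exact: W.
  by rewrite orbC lin_sym (lin_sym i); apply: W; rewrite // lin_sym.
by rewrite !lin_succ_mod; lia.
Qed.

(** Failure would give [j' + 1 < k <= j + 1 <= i + 2 <= j']. *)
Lemma lin_P3_dominates (i j k j' : nat) :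
  j %% 5 = (i %% 5).+1 %% 5 -> k %% 5 = (j %% 5).+1 %% 5 -> j' = j %[mod 5] ->
  lin i j -> lin j k -> lin i j' || lin j' k.
Proof. by move=> ? ? ?; rewrite !lin_succ_mod; lia. Qed.

(** Five non-adjacencies would give [x0 < x1 < x2 < x3 < x4 < x0]. *)
Lemma lin_transversal (x0 x1 x2 x3 x4 : nat) :
  x0 %% 5 = 0 -> x1 %% 5 = 1 -> x2 %% 5 = 2 -> x3 %% 5 = 3 -> x4 %% 5 = 4 ->
  [|| lin x0 x1, lin x1 x2, lin x2 x3, lin x3 x4 | lin x4 x0].
Proof. by move=> *; rewrite !lin_succ_mod; lia. Qed.

(** * Exhaustive search over residue assignments *)

Section Refutation.
Variables (T : eqType) (e : rel T).
Implicit Types (p : T * nat) (s : seq (T * nat)).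

(* A pair [(t, r)] records that the vertex [t] is placed in residue class [r].
   Conditionals replace [&&] and [||] where the second operand is expensive,
   because [vm_compute] evaluates both operands of the latter. *)

Definition improper p s : bool :=
  has (fun q => e p.1 q.1
     && ~~ ((q.2 == p.2.+1 %% 5) || (p.2 == q.2.+1 %% 5))) s.

Definition has_2K2 p s : bool :=
  has (fun q => if e p.1 q.1 then
    has (fun p' => if (p'.2 == p.2) && ~~ e p'.1 q.1 then
      has (fun q' => [&& q'.2 == q.2, e p'.1 q'.1 & ~~ e p.1 q'.1]) s
    else false) s else false) s.

Definition has_undominating_P3 s : bool :=
  has (fun p => has (fun q => if e p.1 q.1 && (q.2 == p.2.+1 %% 5) then
    has (fun r => if e q.1 r.1 && (r.2 == q.2.+1 %% 5) then
      has (fun q' => [&& q'.2 == q.2, ~~ e p.1 q'.1 & ~~ e q'.1 r.1]) s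
    else false) s else false) s) s.

Definition has_transversal s : bool :=
  let C k := [seq q.1 | q <- s & q.2 == k] in
  let D k t := [seq u <- C k | ~~ e t u] in
  has (fun t0 => has (fun t1 => has (fun t2 => has (fun t3 =>
    has (fun t4 => ~~ e t4 t0)
  (D 4 t3)) (D 3 t2)) (D 2 t1)) (D 1 t0)) (C 0).

(** Running out of vertices means that an assignment has survived every test, hence [false]. *)
Fixpoint refuted s (ts : seq T) : bool :=
  if ts is t :: ts' then
    all (fun r => let p := (t, r) in
      if [|| improper p s, has_2K2 p s, has_undominating_P3 (p :: s)
           | has_transversal (p :: s)] then true
      else refuted (p :: s) ts') (iota 0 5)
  else false.

Variable x : T -> nat.
Hypothesis e_lin : forall t u, e t u = lin (x t) (x u).

Let placed s := {in s, forall p, p.2 = x p.1 %% 5}.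

Lemma placed_cons p s : placed (p :: s) -> p.2 = x p.1 %% 5 /\ placed s.
Proof.
move=> pl; split=> [|q qs]; first exact: pl (mem_head _ _).
by apply: pl; rewrite inE qs orbT.
Qed.

Lemma placed_improper p s : placed (p :: s) -> ~~ improper p s.
Proof.
case/placed_cons=> plp pls; apply/hasPn=> q qs; apply/negP=> /andP[].
rewrite e_lin plp (pls q qs).
by move/lin_mod_C5->.
Qed.

Lemma placed_2K2 p s : placed (p :: s) -> ~~ has_2K2 p s.
Proof.
case/placed_cons=> plp pls.
apply/hasPn=> q qs; case: ifP => // epq.
apply/hasPn=> p' p's; case: ifP => // /andP[/eqP Ep np'q].
apply/hasPn=> q' q's; apply/negP=> /and3P[/eqP Eq ep'q' npq'].
move: Ep Eq epq np'q ep'q' npq'; rewrite plp !pls // !e_lin => Ep Eq l n' l' n.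
by have := lin_2K2_free (esym Ep) (esym Eq) l l'; rewrite (negPf n) (negPf n').
Qed.

Lemma placed_P3 s : placed s -> ~~ has_undominating_P3 s.
Proof.
move=> pl; apply/hasPn=> p ps; apply/hasPn=> q qs; case: ifP => // /andP[epq].
rewrite !pl // => /eqP Eq; apply/hasPn=> r rs; case: ifP => // /andP[eqr].
rewrite !pl // => /eqP Er; apply/hasPn=> q' q's; apply/negP=> /and3P[].
rewrite !pl // => /eqP Eq' npq' nq'r; move: epq eqr npq' nq'r.
rewrite !e_lin => l l' n n'; have := lin_P3_dominates Eq Er Eq' l l'.
by rewrite (negPf n) (negPf n').
Qed.

Lemma placed_transversal s : placed s -> ~~ has_transversal s.
Proof.
move=> pl; have plC k t : t \in [seq q.1 | q <- s & q.2 == k] -> x t %% 5 = k.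
  by case/mapP=> q; rewrite mem_filter => /andP[/eqP<- qs ->]; rewrite pl.
apply/hasPn=> t0 /plC E0.
apply/hasPn=> t1; rewrite mem_filter e_lin => /andP[n0 /plC E1].
apply/hasPn=> t2; rewrite mem_filter e_lin => /andP[n1 /plC E2].
apply/hasPn=> t3; rewrite mem_filter e_lin => /andP[n2 /plC E3].
apply/hasPn=> t4; rewrite mem_filter e_lin => /andP[n3 /plC E4].
have := lin_transversal E0 E1 E2 E3 E4.
by rewrite (negPf n0) (negPf n1) (negPf n2) (negPf n3) /= negbK e_lin.
Qed.

(** The branch that follows the true residues of [x] passes every test, so the search cannot close
    it. *)
Lemma placed_not_refuted s ts : placed s -> ~~ refuted s ts.
Proof.
elim: ts s => // t ts IH s pl; set p := (t, x t %% 5).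
have plp : placed (p :: s).
  by move=> q; rewrite inE => /predU1P[->|/pl].
apply/allPn; exists (x t %% 5); first by rewrite mem_iota ltn_pmod.
rewrite -/p /= (negPf (placed_improper plp)) (negPf (placed_2K2 plp)).
by rewrite (negPf (placed_P3 plp)) (negPf (placed_transversal plp)) IH.
Qed.

End Refutation.

Lemma refuted_not_lin (F : sgraph) (ts : seq F) (x : F -> nat) :
  refuted (@adj F) [::] ts -> ~ (forall u v, adj u v = lin (x u) (x v)).
Proof. by move=> ref Ex; move: ref; apply/negP/(placed_not_refuted Ex). Qed.

(** * The circulants and their unrolling at a missing vertex *)

Section Circulant.
Variable n : nat.
Let N := 5 * n + 18.

Definition circ_adj : rel 'I_N :=
  fun i j => [|| lin i j, j - i == N.-1 | i - j == N.-1].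

Lemma circ_sym : symmetric circ_adj.
Proof. by move=> i j; rewrite /circ_adj lin_sym [X in _ || X]orbC. Qed.

Lemma circ_irr : irreflexive circ_adj.
Proof. by move=> i; rewrite /circ_adj /lin consecutive_irr subnn /N; lia. Qed.

Definition circ : sgraph := SGraph circ_sym circ_irr.

(** Since [N = 3] mod 5, [d] and [N - d] are 4 mod 5 together; a difference of [N.-1] turns into a
    consecutive pair. *)
Lemma circ_adj_across (i j z : nat) : i < z -> z < j -> j < N ->
  [|| lin i j, j - i == N.-1 | i - j == N.-1] = lin (i + N) j.
Proof.
move=> iz zj jN; have ij : i.+1 < j by lia.
have -> : lin i j = ((j - i) %% 5 == 4) by rewrite /lin /consecutive; lia.
have -> : (i - j == N.-1) = false by lia.
have -> : lin (i + N) j = (j - i == N.-1) || ((N - (j - i)) %% 5 == 4).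
  by rewrite /lin /consecutive; have -> : N - (j - i) = i + N - j by [lia]; lia.
have -> : (N - (j - i)) %% 5 == 4 = ((j - i) %% 5 == 4) by lia.
by rewrite orbF orbC.
Qed.

(** The circle is read from just after [z], so the vertices before [z] move past the last one. *)
Definition unroll (z i : circ) : nat := if z < i then i : nat else i + N.

Lemma lin_addr (i j k : nat) : lin (i + k) (j + k) = lin i j.
Proof. by rewrite /lin /consecutive !subnDr -!addSn !eqn_add2r. Qed.

Lemma unroll_lin (z i j : circ) :
  i != z -> j != z -> adj i j = lin (unroll z i) (unroll z j).
Proof.
rewrite -!val_eqE /= /unroll => iz jz.
have [iN jN zN] := And3 (ltn_ord i) (ltn_ord j) (ltn_ord z).
case: (ltngtP z i) iz => // zi _; case: (ltngtP z j) jz => // zj _.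
- rewrite /circ_adj; have -> : (j - i == N.-1) = false by lia.
  by have -> : (i - j == N.-1) = false by [lia]; rewrite !orbF.
- by rewrite lin_sym -(circ_adj_across zj zi iN) circ_sym.
- exact: circ_adj_across zi zj jN.
rewrite lin_addr /circ_adj; have -> : (j - i == N.-1) = false by lia.
by have -> : (i - j == N.-1) = false by [lia]; rewrite !orbF.
Qed.

Lemma circ_gt0 : 0 < N.
Proof. by rewrite /N addn_gt0 orbT. Qed.

Definition circ_vertex (i : nat) : circ := Ordinal (ltn_pmod i circ_gt0).

Lemma circ_vertex_adj (i d : nat) :
  d \in [:: 1; 4] -> adj (circ_vertex i) (circ_vertex (i + d)).
Proof.
move=> dd; rewrite /= /circ_adj /= -modnDml.
have: i %% N < N by rewrite ltn_pmod ?circ_gt0.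
move: (i %% N) => r rN; have [rdN|Nrd] := ltnP (r + d) N.
  rewrite modn_small // /lin /consecutive addKn.
  by move: dd; rewrite !inE => /orP[] /eqP->; rewrite ?addn1 ?eqxx ?orbT.
(* After wrapping, the difference is [N - d]: this is [N.-1] for [d = 1], and 4 mod 5 for
   [d = 4]. *)
rewrite -(subnKC Nrd) modnDl modn_small; last by move: dd; rewrite !inE; lia.
by rewrite /lin /consecutive; move: dd Nrd; rewrite !inE => /orP[] /eqP->; lia.
Qed.

Lemma circ_vertexN (i : nat) : circ_vertex (i + N) = circ_vertex i.
Proof. by apply: val_inj; rewrite /= modnDr. Qed.

End Circulant.

(** * Minimality as obstructions *)

Lemma C5_coloring_period (a0 a1 a2 a3 a4 a5 : C5) :
  adj a0 a1 -> adj a1 a2 -> adj a2 a3 -> adj a3 a4 -> adj a4 a5 ->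
  adj a0 a4 -> adj a1 a5 -> a5 = a0.
Proof.
move=> h01 h12 h23 h34 h45 h04 h15; apply: val_inj; move: h01 h12 h23 h34 h45 h04 h15.
case: a0 a1 a2 a3 a4 a5 => [a0 l0] [a1 l1] [a2 l2] [a3 l3] [a4 l4] [a5 l5] /=.
(* [a0], ..., [a4] run once around [C5], so [a0] is the only common neighbor of [a1] and [a4]. *)
rewrite /C5_adj /=; lia.
Qed.

Lemma circ_not_colorable n : ~ colorable C5 (circ n).
Proof.
move=> [c hc]; pose f i := c (circ_vertex n i).
have f1 i : adj (f i) (f (i + 1)) by apply: hc; apply: circ_vertex_adj.
have f4 i : adj (f i) (f (i + 4)) by apply: hc; apply: circ_vertex_adj.
have f5 i : f (i + 5) = f i.
  apply: (@C5_coloring_period (f i) (f (i + 1)) (f (i + 2)) (f (i + 3)) (f (i + 4))).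
  - exact: f1.
  - by have := f1 (i + 1); rewrite -addnA.
  - by have := f1 (i + 2); rewrite -addnA.
  - by have := f1 (i + 3); rewrite -addnA.
  - by have := f1 (i + 4); rewrite -addnA.
  - exact: f4.
  - by have := f4 (i + 1); rewrite -addnA.
have f5k k i : f (i + 5 * k) = f i.
  by elim: k => [|k IH]; rewrite ?muln0 ?addn0 // mulnS addnCA addnC -IH f5.
have f3 i : f (i + 3) = f i.
  (* [3 + 5 * (n + 3) = N] is one full turn. *)
  rewrite -(f5k (n + 3)) {2}/f -(circ_vertexN n i) /f; congr (c (circ_vertex n _)); lia.
(* Both sides equal [f 6], as [1 + 5 = 0 + 3 + 3]. *)
have := f1 0; have -> : f (0 + 1) = f 0 by rewrite -f5 -(f3 0) -(f3 (0 + 3)).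
by rewrite adj_irr.
Qed.

Lemma circ_minimal n : minimal_obstruction C5 (circ n).
Proof.
split=> [|A /properP[_ [z _ zA]]]; first exact: circ_not_colorable.
exists (fun u => Ordinal (ltn_pmod (unroll z (val u)) (isT : 0 < 5))) => u v.
have nz (w : {x : circ n | x \in A}) : val w != z.
  by apply: contraNneq zA => <-; apply: valP.
rewrite -[adj u v]/(@adj (circ n) (val u) (val v)).
by rewrite (unroll_lin (nz u) (nz v)) => /lin_mod_C5.
Qed.

(** * Excluding the forbidden trees *)

Lemma circ_free n (F : sgraph) (ts : seq F) :
  #|F| < 18 -> refuted (@adj F) [::] ts -> free F (circ n).
Proof.
move=> F18 ref [A [f bij_f hf]].
have cardA : #|A| = #|F| by rewrite (bij_eq_card bij_f) card_sig.
have [z _ zA] : exists2 z, z \in [set: circ n] & z \notin A.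
  (* The circulant has at least 18 vertices, more than [F]. *)
  apply/subsetPn/negP=> /subset_leq_card; rewrite cardsT card_ord cardA; lia.
have nz w : val (f w) != z by apply: contraNneq zA => <-; apply: valP.
apply: (refuted_not_lin (x := fun w => unroll z (val (f w))) ref) => u v.
by rewrite -(unroll_lin (nz u) (nz v)) -hf.
Qed.

Lemma circ_not_isomorphic m n : m <> n -> ~ isomorphic (circ m) (circ n).
Proof. by move=> mn [f /bij_eq_card + _]; rewrite !card_ord; lia. Qed.

(* Unlike [enum 'I_n], this list reduces under [vm_compute]. *)
Fixpoint ords n : seq 'I_n :=
  if n is n'.+1 then ord0 :: [seq lift ord0 i | i <- ords n'] else [::].

Definition spider_vertices a b c : seq (spider a b c) :=
  None :: [seq Some (inl (inl i)) | i <- ords a]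
       ++ [seq Some (inl (inr i)) | i <- ords b]
       ++ [seq Some (inr i) | i <- ords c].

Lemma circ_spider_free n a b c : a + b + c < 17 ->
  refuted (@adj (spider a b c)) [::] (spider_vertices a b c) ->
  free (spider a b c) (circ n).
Proof.
by move=> abc; apply: circ_free; rewrite card_option !card_sum !card_ord.
Qed.

Theorem theorem3 :
  exists G : nat -> sgraph,
    (forall m n : nat, m <> n -> ~ isomorphic (G m) (G n)) /\
    (forall n : nat,
       minimal_obstruction C5 (G n) /\
       free (path_graph 13) (G n) /\
       free (spider 2 2 2) (G n) /\
       free (spider 5 5 1) (G n) /\
       free (spider 11 1 1) (G n) /\
       free (spider 8 2 1) (G n)).
Proof.
exists circ; split=> [|n]; first exact: circ_not_isomorphic.
split; first exact: circ_minimal.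
split.
  by apply: (@circ_free n (path_graph 13) (ords 13)); [rewrite card_ord | vm_compute].
by do ![split]; (apply: circ_spider_free; last by vm_compute).
Qed.
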